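(* For every real $p\in[1,\infty)$, $$\sup_{n\geq2}\Gamma_{2^n}(B_p^n)\leq\left(\frac56\right)^{1/p},$$ where the supremum is over integers $n\geq 2$.
   Context: For a convex body $K\subset\mathbb{R}^n$ (compact convex set with nonempty interior) and an integer $m\geq1$, $$\Gamma_m(K)=\inf\Big\{\gamma>0:\ \exists\, c_1,\ldots,c_m\in\mathbb{R}^n\ \text{such that}\ K\subseteq\bigcup_{i=1}^m(c_i+\gamma K)\Big\}.$$ $B_p^n=\{x\in\mathbb{R}^n:\ \|x\|_p\leq1\}$, where $\|\cdot\|_p$ is the standard $p$-norm on $\mathbb{R}^n$. *)

(* Defs.v *)
From HB Require Import structures.
From mathcomp Require Import all_boot all_order all_algebra.
From mathcomp Require Import all_classical all_reals all_analysis.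

Set Implicit Arguments.
Unset Strict Implicit.
Unset Printing Implicit Defensive.

Import Order.TTheory GRing.Theory Num.Theory.

Local Open Scope classical_set_scope.
Local Open Scope ring_scope.

Definition pnorm (R : realType) (p : R) (n : nat) (x : 'rV[R]_n) : R :=
  (\sum_(i < n) `|x ord0 i| `^ p) `^ p^-1.

Definition pball (R : realType) (p : R) (n : nat) : set 'rV[R]_n :=
  [set x | pnorm p x <= 1].

Arguments pball {R} p n _.

Definition homothet (R : realType) (n : nat) (c : 'rV[R]_n) (g : R)
    (K : set 'rV[R]_n) : set 'rV[R]_n :=
  [set c + g *: x | x in K].

(* The infimum is taken in the extended reals, so it has its standard meaning
   for every set K and every m, whether or not the set of ratios is empty. *)
Definition Gamma (R : realType) (n m : nat) (K : set 'rV[R]_n) : \bar R :=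
  ereal_inf [set g%:E | g in [set g : R | 0 < g /\
    exists c : 'I_m -> 'rV[R]_n,
      K `<=` \bigcup_(i in [set: 'I_m]) homothet (c i) g K]].

(* Main.v *)
Require Import Defs.
From Stdlib Require Import BinNat Nnat.
From mathcomp Require Import all_boot all_order all_algebra.
From mathcomp Require Import all_classical all_reals all_analysis.
From mathcomp Require Import zify ring lra.

Set Implicit Arguments.
Unset Strict Implicit.
Unset Printing Implicit Defensive.

Import Order.TTheory GRing.Theory Num.Theory.

(** With y_i = |x_i|^p, superadditivity of t^p gives |s - t|^p <= |s^p - t^p|
for s, t >= 0, so it suffices to approximate y in l^1 up to 5/6 by a vector
with entries in (1/n)N; its p-th roots, with the signs of x, form the centre.
Put F = sum_i floor(n y_i) and fix an integer k.  If F >= k, round n y down to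
an integer vector of sum k.  Otherwise round it down and add 1 to k - F entries
whose fractional parts are at least average; if sum_i y_i <= 1 and 2k <= n, the
l^1 error is at most n - k + 2F(k - F)/n <= n - k + k^2/(2n), which is at most
5n/6 for n/5 <= k <= n.  The centres are thus indexed by the integer vectors of
l^1 norm k, and for k = ceil(n/5) (k = 1 if n <= 6) there are at most 2^n. *)

(** * Integer vectors of given l^1 norm: counting them and choosing the norm *)

(* The number of integer vectors of length n and l^1 norm k. *)
Fixpoint sphere_card (n : nat) : nat -> nat :=
  if n is n'.+1 then
    fix g k := if k is k'.+1 then
      (sphere_card n' k'.+1 + sphere_card n' k' + g k')%N else 1%N
  else fun k => (k == 0 :> nat)%N.

Lemma sphere_cardS n k : sphere_card n.+1 k.+1 =
  (sphere_card n k.+1 + sphere_card n k + sphere_card n.+1 k)%N.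
Proof. by []. Qed.

Lemma sphere_card0 n : sphere_card n 0 = 1%N.
Proof. by case: n. Qed.

Definition l1norm (v : seq int) : nat := (\sum_(a <- v) `|a|)%N.

Lemma sphere_enum n k : exists s : seq (seq int), size s = sphere_card n k /\
  forall v, size v = n -> l1norm v = k -> v \in s.
Proof.
rewrite /l1norm; elim: n k => [|n IHn] k.
  exists (nseq (k == 0)%N [::]); split; first by rewrite size_nseq.
  by move=> v /size0nil ->; rewrite big_nil => <-.
elim: k => [|k [s [sz_s in_s]]].
  exists [:: nseq n.+1 0%R]; split=> // v sz_v /eqP; rewrite big_tnth sum_nat_eq0.
  move=> /forallP v0; rewrite inE; apply/eqP/(@eq_from_nth _ 0%R).
    by rewrite size_nseq.
  move=> i lt_i; rewrite nth_nseq -sz_v lt_i.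
  have /= := v0 (Ordinal lt_i); rewrite (tnth_nth 0%R) absz_eq0 /=.
  by move/eqP.
have [s0 [sz0 in0]] := IHn k.+1; have [s1 [sz1 in1]] := IHn k.
(* The vectors with nonzero head other than -1 are obtained from those of norm k
   by moving the head away from 0, where 0 itself moves to 1. *)
pose bump (v : seq int) :=
  if v is a :: w then (if (0 <= a)%R then a + 1 else a - 1)%R :: w else [::].
exists (map (cons 0%R) s0 ++ map (cons (-1)%R) s1 ++ map bump s); split.
  by rewrite !size_cat !size_map sz0 sz1 sz_s sphere_cardS addnA.
case=> // a v [sz_v]; rewrite big_cons !mem_cat => norm_v.
have [a0|a_neq0] := eqVneq a 0%R.
  by rewrite a0 map_f // in0 // -norm_v a0.
have [a1|a_neq1] := eqVneq a (-1)%R.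
  by rewrite a1 [X in _ || (X || _)]map_f ?orbT //; apply: in1 => //;
    apply: eq_add_S; rewrite -norm_v a1.
have -> : a :: v = bump ((if (0 <= a)%R then a - 1 else a + 1)%R :: v).
  rewrite /bump; case: (leP 0%R a) => a_sgn.
    by rewrite ifT ?subrK //; lia.
  by rewrite ifF ?addrK //; lia.
rewrite [X in _ || (_ || X)]map_f ?orbT //; apply: in_s; rewrite /= ?sz_v //.
move: norm_v; rewrite big_cons; move: (\sum_(i <- v) _)%N => t.
by case: (leP 0%R a) => ?; lia.
Qed.

(* Evaluating the generating function ((1+z)/(1-z))^n at z = 1/9. *)
Lemma sphere_card_le n k : (sphere_card n k * 4 ^ n <= 9 ^ k * 5 ^ n)%N.
Proof.
elim: n k => [|n IHn] k; first by rewrite !muln1; case: k => //= k; rewrite expn_gt0.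
elim: k => [|k IHk]; first by rewrite sphere_card0 !mul1n leq_exp2r.
(* The three bounds contribute 4 * 9, 4 and 5, which add up to exactly 9 * 5. *)
rewrite sphere_cardS; move: (IHn k.+1) (IHn k) IHk; rewrite !expnS.
move: (sphere_card n k.+1) (sphere_card n k) (sphere_card n.+1 k) => a b c.
move: (4 ^ n)%N (9 ^ k)%N (5 ^ n)%N => x y z; nia.
Qed.

(* The bound at z = 1/9 is too weak for n <= 60, where the exact values are
   tabulated in binary. *)
Fixpoint next_row (p q : N) (r : seq N) : seq N :=
  if r is x :: r' then let y := (x + p + q)%num in y :: next_row x y r' else [::].

(** Thirteen columns suffice, as [(n + 4) %/ 5 <= 12] for [n <= 60]. The seeds [0 0] stand for the
    left neighbours of column 0, which thus keeps the value 1. *)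
Definition sphere_row n := iter n (next_row 0 0) (1%num :: nseq 12 0%num).

Lemma next_rowE n k l :
  next_row (N.of_nat (sphere_card n k)) (N.of_nat (sphere_card n.+1 k))
    [seq N.of_nat (sphere_card n i) | i <- iota k.+1 l] =
  [seq N.of_nat (sphere_card n.+1 i) | i <- iota k.+1 l].
Proof.
elim: l k => // l IHl k; rewrite -[iota _ _]/(k.+1 :: iota k.+2 l) !map_cons -IHl.
have -> : N.of_nat (sphere_card n.+1 k.+1) = (N.of_nat (sphere_card n k.+1) +
    N.of_nat (sphere_card n k) + N.of_nat (sphere_card n.+1 k))%num.
  by rewrite -!Nat2N.inj_add.
by [].
Qed.

Lemma sphere_rowE n :
  sphere_row n = [seq N.of_nat (sphere_card n i) | i <- iota 0 13].
Proof.
elim: n => [//|n IHn]; rewrite /sphere_row iterS -/(sphere_row n) IHn.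
rewrite -[iota 0 13]/(0%N :: iota 1 12) [in LHS]map_cons [in RHS]map_cons.
by rewrite -next_rowE !sphere_card0.
Qed.

Lemma sphere_row_check :
  all (fun n => N.leb (nth 0%num (sphere_row n) ((n + 4) %/ 5)) (N.pow 2 (N.of_nat n)))
    (iota 7 54).
Proof. by vm_compute. Qed.

Lemma of_nat_exp a n : N.of_nat (a ^ n) = N.pow (N.of_nat a) (N.of_nat n).
Proof.
elim: n => // n IHn.
by rewrite expnS Nat2N.inj_mul IHn (Nat2N.inj_succ n) N.pow_succ_r'.
Qed.

(** 61 is the least [n] with [(n + 4) %/ 5 = 13]; since 8 = 2 * 4, [sphere_card_le] then settles
    this [n]. *)
Lemma ratio_start : (9 ^ 13 * 5 ^ 61 <= 8 ^ 61)%N.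
Proof.
have : N.leb (9 ^ 13 * 5 ^ 61)%num (8 ^ 61)%num by vm_compute.
rewrite -(of_nat_exp 9 13) -(of_nat_exp 5 61) -(of_nat_exp 8 61) -Nat2N.inj_mul.
move: (9 ^ 13)%N (5 ^ 61)%N (8 ^ 61)%N => a b c /N.leb_spec0; lia.
Qed.

(** When [n] grows by 5, [k] grows by 1 and the two sides gain the factors 9 * 5^5 = 28125 and 8^5 =
    32768. The remaining [s] units leave [k] fixed. *)
Lemma ratio_step a b j s : (9 ^ a * 5 ^ b <= 8 ^ b)%N ->
  (9 ^ (j + a) * 5 ^ (5 * j + b + s) <= 8 ^ (5 * j + b + s))%N.
Proof.
move=> start.
have step : (9 ^ j * 5 ^ (5 * j) <= 8 ^ (5 * j))%N.
  rewrite !(expnM _ 5) -expnMn; case: (posnP j) => [->//|j_gt0].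
  by rewrite leq_exp2r.
have tail : (5 ^ s <= 8 ^ s)%N by case: (posnP s) => [->//|s_gt0]; rewrite leq_exp2r.
move: (5 * j)%N step => e step.
rewrite !expnD; apply: leq_trans (leq_mul (leq_mul step start) tail).
by rewrite mulnA (mulnACA (9 ^ j)) leqnn.
Qed.

Lemma sphere_card_le_exp2 n : (6 < n)%N -> (sphere_card n ((n + 4) %/ 5) <= 2 ^ n)%N.
Proof.
move=> n_gt6; have [n_gt60|n_le60] := ltnP 60 n; last first.
  have := allP sphere_row_check n; rewrite mem_iota n_gt6 /= => /(_ n_le60).
  have lt13 : ((n + 4) %/ 5 < 13)%N by lia.
  rewrite sphere_rowE (nth_map 0%N) ?size_iota // nth_iota // add0n.
  by rewrite -(of_nat_exp 2) => /N.leb_spec0; lia.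
rewrite -(leq_pmul2r (expn_gt0 4 n : (0 < 4 ^ n)%N)).
apply: leq_trans (sphere_card_le _ _) _; rewrite -expnMn.
pose j := (n - 61) %/ 5.
pose s := (n - 61) %% 5.
have -> : ((n + 4) %/ 5 = j + 13)%N by rewrite /j; lia.
have -> : n = (5 * j + 61 + s)%N by rewrite /j /s; lia.
exact/ratio_step/ratio_start.
Qed.

Local Open Scope ring_scope.

(** The second condition is the error bound n - k + 2F(k - F)/n <= 5n/6 multiplied by 6n. *)
Lemma exists_lattice_radius n : (1 < n)%N -> exists k, [/\ (2 * k <= n)%N,
  forall F, (F <= k)%N -> (n * n + 12 * (F * (k - F)) <= 6 * (k * n))%N &
  (sphere_card n k <= 2 ^ n)%N].
Proof.
move=> n_gt1; have [n_gt6|n_le6] := ltnP 6 n; last first.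
  (* Here the count is 2n <= 2^n. The ceiling of n/5 would fail at n = 6: it is 2, and 72 vectors
     have norm 2. *)
  exists 1%N; split; first by [].
    by move=> [|[|F]] //; nia.
  by move: n n_gt1 n_le6 => [|[|[|[|[|[|[|n]]]]]]].
exists ((n + 4) %/ 5)%N; split; last exact: sphere_card_le_exp2.
  lia.
set k := (_ %/ 5)%N; have k_lo : (n <= 5 * k)%N by rewrite /k; lia.
have k_hi : (k <= n)%N by rewrite /k; lia.
move: k k_lo k_hi => k k_lo k_hi F F_le.
have AMGM : (4 * (F * (k - F)) <= k * k)%N.
  have [d ->] : exists d, k = (F + d)%N by exists (k - F)%N; lia.
  by rewrite addKn mulnn nat_AGM2.
(* Neither difference truncates, so this expands to n^2 + 5k^2 <= 6kn, while [AMGM] leaves only n^2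
   + 3k^2 to bound. *)
have : (0 <= (5 * k - n) * (n - k))%N by [].
nia.
Qed.

(** * Rounding to integer vectors of prescribed sum *)

Lemma exists_le_sum_eq (I : finType) (f : I -> nat) k : (k <= \sum_i f i)%N ->
  exists2 m : I -> nat, forall i, (m i <= f i)%N & (\sum_i m i = k)%N.
Proof.
elim: k => [|k IHk] le_k; first by exists (fun=> 0%N); rewrite ?big1.
have [m le_m sum_m] := IHk (ltnW le_k).
have /existsP[j lt_j] : [exists j, m j < f j]%N.
  apply: contraTT le_k => /existsPn ge_m; rewrite -leqNgt -sum_m.
  by apply: leq_sum => i _; rewrite leqNgt.
exists (fun i => m i + (i == j))%N => [i|].
  by case: eqP => [->|_]; rewrite ?addn1 ?addn0.
by rewrite big_split sum_m -big_mkcond /= big_pred1_eq addn1.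
Qed.

(** Starting from the full set, repeatedly discard a minimal element; this cannot lower the
    average. *)
Lemma exists_heavy_subset (R : realFieldType) (I : finType) (r : I -> R) j :
  (j <= #|I|)%N -> exists2 T : {set I}, #|T| = j &
    j%:R * (\sum_i r i) <= #|I|%:R * \sum_(i in T) r i.
Proof.
move=> le_j; rewrite -(subKn le_j); elim: (_ - j)%N => [|d [T card_T heavy_T]].
  exists [set: I]; rewrite ?cardsT subn0 //.
  by rewrite [in leRHS](eq_bigl xpredT) // => i; rewrite inE.
(* Once the truncated subtraction has reached 0, the set no longer changes. *)
have [le_d|lt_d] := leqP #|I| d.
  by exists T; rewrite (_ : #|I| - d.+1 = #|I| - d)%N //; lia.
have [i0 T_i0] : exists i0, i0 \in T by apply/card_gt0P; lia.
have [x xT min_x] := arg_minP r T_i0.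
have T_x : x \in T := xT.
exists (T :\ x); first by have := cardsD1 x T; rewrite T_x; lia.
have sum_T : \sum_(i in T) r i = r x + \sum_(i in T :\ x) r i.
  by rewrite (big_setD1 x).
have avg_x : #|T|%:R * r x <= \sum_(i in T) r i.
  by rewrite -sumr_const mulr_suml; apply: ler_sum => i /min_x; rewrite mul1r.
have -> : (#|I| - d.+1 = #|T|.-1)%N by rewrite card_T; lia.
have T_gt0 : (0 < #|T|)%N by rewrite card_T; lia.
move: heavy_T avg_x; rewrite -card_T sum_T.
move: (\sum_(i in _) r i) (\sum_i r i) (r x) => U S rx.
case: #|T| T_gt0 => // t _; rewrite -natr1 => heavy_T avg_x.
have N_ge0 : 0 <= #|I|%:R :> R by exact: ler0n.
have t_ge0 : 0 <= t%:R :> R by exact: ler0n.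
(* As [t] may be 0, the goal is scaled by [t + 1] and [heavy_T] by [t]; what remains is
   [t * rx <= U], which is [avg_x]. *)
rewrite -(ler_pM2l (_ : 0 < t%:R + 1)); last by lra.
have := ler_wpM2l t_ge0 heavy_T.
have : #|I|%:R * (t%:R * rx) <= #|I|%:R * U by apply: ler_wpM2l; lra.
lra.
Qed.

Lemma exists_rounding (R : realType) n k (a : 'I_n -> R) : (2 * k <= n)%N ->
  (forall F, (F <= k)%N -> (n * n + 12 * (F * (k - F)) <= 6 * (k * n))%N) ->
  (forall i, 0 <= a i) -> \sum_i a i <= n%:R ->
  exists2 m : 'I_n -> nat, (\sum_i m i = k)%N &
    6 * \sum_i `|a i - (m i)%:R| <= 5 * n%:R.
Proof.
move=> k_half k_ok a_ge0 sum_a.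
pose fl i := Num.truncn (a i).
have fl_le i : (fl i)%:R <= a i by rewrite truncn_le.
have fl_gt i : a i < (fl i)%:R + 1 by have := truncnS_gt (a i); rewrite -natr1.
have [ge_F|lt_F] := leqP k (\sum_i fl i)%N.
  have [m le_m sum_m] := exists_le_sum_eq ge_F; exists m => //.
  have -> : \sum_i `|a i - (m i)%:R| = \sum_i a i - k%:R.
    rewrite -sum_m natr_sum -sumrB; apply: eq_bigr => i _; rewrite ger0_norm //.
    by rewrite subr_ge0 (le_trans _ (fl_le i)) // ler_nat.
  (* At F = k the product in [k_ok] vanishes; the error is at most n - k. *)
  have : (n <= 6 * k)%N.
    have := k_ok k (leqnn k); rewrite subnn !muln0 addn0 mulnA.
    by case: (posnP n) => [->//|n_gt0]; rewrite leq_pmul2r.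
  rewrite -(ler_nat R) natrM.
  lra.
set F := (\sum_i fl i)%N in lt_F.
pose r i := a i - (fl i)%:R.
have [T card_T heavy_T] := @exists_heavy_subset _ _ r (k - F) ltac:(by rewrite card_ord; lia).
exists (fun i => fl i + (i \in T))%N.
  by rewrite big_split -/F /= -big_mkcond sum1_card card_T; lia.
(* Rounding up at [i] replaces the error [r i] by [1 - r i]. *)
have -> : \sum_i `|a i - (fl i + (i \in T))%:R| =
    \sum_i r i + (k - F)%:R - 2 * \sum_(i in T) r i.
  rewrite -card_T -sum1_card natr_sum mulr_sumr -addrA -sumrB.
  rewrite [X in _ + X]big_mkcond -big_split; apply: eq_bigr => i _ /=.
  have r_ge0 : 0 <= r i by rewrite subr_ge0.
  have r_lt1 : r i < 1 by rewrite ltrBlDl.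
  rewrite natrD opprD addrA -/(r i); case: (i \in T) => /=.
    by rewrite ler0_norm; lra.
  by rewrite subr0 addr0 ger0_norm.
have sum_r : \sum_i r i <= n%:R - F%:R by rewrite sumrB -natr_sum lerB.
have := k_ok F (ltnW lt_F); rewrite card_ord in heavy_T.
move: heavy_T; set j := (k - F)%N => heavy_T.
rewrite (_ : k = j + F)%N; last by rewrite /j; lia.
rewrite -(ler_nat R) !(natrD, natrM) => k_ok'.
have : 2 * j%:R <= n%:R :> R by rewrite -natrM ler_nat /j; lia.
have n_gt0 : (0 < n)%N by lia.
move: heavy_T sum_r k_ok'.
have : 0 < n%:R :> R by rewrite ltr0n.
move: (\sum_i r i) (\sum_(i in T) r i) n%:R j%:R F%:R => S ST N J G.
move=> N_gt0 heavy_T sum_r k_ok' J_half; rewrite -(ler_pM2l N_gt0).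
(* Once [ST] is bounded below by [J * S / N], the error has slope [1 - 2 * J / N >= 0] in [S], so
   the worst case is [S = N - G], where [k_ok'] applies. *)
have : 0 <= (N - 2 * J) * (N - G - S) by apply: mulr_ge0; lra.
lra.
Qed.

(** * From l^1 to l^p *)

(** Write t^p as t * t^(p-1) and bound u^(p-1) and v^(p-1) by (u + v)^(p-1). *)
Lemma powRD_ge (R : realType) (p u v : R) : 1 <= p -> 0 <= u -> 0 <= v ->
  u `^ p + v `^ p <= (u + v) `^ p.
Proof.
move=> p_ge1 u_ge0 v_ge0; have p_gt0 : 0 < p by lra.
rewrite -(mulr_powRB1 u_ge0) // -(mulr_powRB1 v_ge0) //.
rewrite -(mulr_powRB1 (addr_ge0 u_ge0 v_ge0)) // mulrDl.
by apply: lerD; apply: ler_wpM2l => //; apply: ge0_ler_powR; rewrite ?nnegrE; lra.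
Qed.

Lemma dist_powR_le (R : realType) (p u v : R) : 1 <= p -> 0 <= u -> 0 <= v ->
  `|u - v| `^ p <= `|u `^ p - v `^ p|.
Proof.
move=> p_ge1; wlog le_vu : u v / v <= u => [wl u_ge0 v_ge0|u_ge0 v_ge0].
  have [le_vu|/ltW le_uv] := leP v u; first exact: wl.
  by rewrite distrC [leRHS]distrC; apply: wl.
rewrite ger0_norm ?subr_ge0 //; apply: le_trans (ler_norm _).
by rewrite lerBrDr -{2}(subrK v u) powRD_ge // subr_ge0.
Qed.

(** * Covering the ball *)

(** This inverts the coordinatewise map sending t to n sgn(t) |t|^p. *)
Definition lattice_center (R : realType) (p : R) n (v : seq int) : 'rV[R]_n :=
  \row_i ((-1) ^+ (v`_i < 0)%R * ((absz v`_i)%:R / n%:R) `^ p^-1).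

Lemma pball_covered (R : realType) (p : R) n k (x : 'rV[R]_n) : 1 <= p ->
  (0 < n)%N -> (2 * k <= n)%N ->
  (forall F, (F <= k)%N -> (n * n + 12 * (F * (k - F)) <= 6 * (k * n))%N) ->
  pball p n x -> exists v, [/\ size v = n, l1norm v = k &
    homothet (lattice_center p n v) ((5 / 6) `^ p^-1) (pball p n) x].
Proof.
move=> p_ge1 n_gt0 k_half k_ok; rewrite /pball /= /pnorm => x_ball.
have p_gt0 : 0 < p by lra.
have p_neq0 : p != 0 by rewrite gt_eqF.
have nR_gt0 : 0 < n%:R :> R by rewrite ltr0n.
have pow1 (q : R) : 1 `^ q = 1 :> R by rewrite powR1.
have powK (y : R) : 0 <= y -> (y `^ p^-1) `^ p = y.
  by move=> y_ge0; rewrite -powRrM mulVf // powRr1.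
have sum_le1 : \sum_i `|x ord0 i| `^ p <= 1.
  have sum_ge0 : 0 <= \sum_i `|x ord0 i| `^ p by apply: sumr_ge0 => i _; exact: powR_ge0.
  rewrite -[leLHS]powK //.
  by rewrite -(pow1 p); apply: ge0_ler_powR; rewrite ?nnegrE ?powR_ge0 // ltW.
pose a i := n%:R * `|x ord0 i| `^ p.
have [||m sum_m dist_m] := exists_rounding k_half k_ok (a := a).
- by move=> i; rewrite mulr_ge0 ?powR_ge0 ?ler0n.
- by rewrite -mulr_sumr ler_piMr ?ler0n.
pose w i : int := (-1) ^+ (x ord0 i < 0)%R * (m i)%:Z.
have abs_w i : absz (w i) = m i by rewrite abszMsign.
have sgn_w i : (0 < m i)%N -> (w i < 0) = (x ord0 i < 0).
  by rewrite /w; case: (x ord0 i < 0) => m_gt0; rewrite ?mulN1r ?mul1r; lia.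
pose v := [seq w i | i <- enum 'I_n].
have vE (i : 'I_n) : v`_i = w i.
  by rewrite (nth_map i) ?size_enum_ord // nth_ord_enum.
exists v; split; first by rewrite size_map size_enum_ord.
  by rewrite /l1norm big_map big_enum /= -sum_m; apply: eq_bigr => i _; rewrite abs_w.
set c := lattice_center p n v; set g := (5 / 6) `^ p^-1.
have g_gt0 : 0 < g by rewrite powR_gt0; lra.
exists (g^-1 *: (x - c)); last by rewrite scalerA mulfV ?gt_eqF // scale1r addrC subrK.
rewrite /= -(pow1 p^-1); apply: ge0_ler_powR.
- by rewrite invr_ge0 ltW.
- by rewrite nnegrE sumr_ge0 // => i _; exact: powR_ge0.
- by rewrite nnegrE ler01.
have dist_c i : `|x ord0 i - c ord0 i| `^ p <= `|a i - (m i)%:R| / n%:R.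
  have -> : `|x ord0 i - c ord0 i| = `| `|x ord0 i| - ((m i)%:R / n%:R) `^ p^-1|.
    (* If [m i = 0], then [w i] has lost the sign of [x], but the coordinate of the centre is 0
       anyway. *)
    rewrite mxE vE abs_w; case: (posnP (m i)) => [->|m_gt0].
      by rewrite mul0r powR0 ?invr_eq0 // mulr0 !subr0 normr_id.
    rewrite sgn_w //; case: ltP => [x_lt0|x_ge0]; last first.
      by rewrite expr0 mul1r (ger0_norm x_ge0).
    by rewrite expr1 mulN1r (ltr0_norm x_lt0) -[RHS]normrN opprD !opprK.
  apply: le_trans (dist_powR_le p_ge1 _ (powR_ge0 _ _)) _ => //.
  rewrite powK ?divr_ge0 ?ler0n //.
  have -> : `|x ord0 i| `^ p - (m i)%:R / n%:R = (a i - (m i)%:R) / n%:R.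
    by rewrite /a; field; rewrite gt_eqF.
  by rewrite normrM normfV (gtr0_norm nR_gt0).
(* Since g^p = 5/6, dividing by [g] multiplies p-th powers by 6/5, which offsets the l^1 error
   5/6. *)
have -> : \sum_i `|(g^-1 *: (x - c)) ord0 i| `^ p =
    6 / 5 * \sum_i `|x ord0 i - c ord0 i| `^ p.
  rewrite mulr_sumr; apply: eq_bigr => i _; rewrite !mxE normrM powRM //.
  congr (_ * _); rewrite gtr0_norm ?invr_gt0 //.
  have : g^-1 `^ p * g `^ p = 1.
    by rewrite -powRM ?invr_ge0 ?(ltW g_gt0) // mulVf ?gt_eqF.
  rewrite powK; lra.
have : \sum_i `|x ord0 i - c ord0 i| `^ p <= (\sum_i `|a i - (m i)%:R|) / n%:R.
  by rewrite mulr_suml; apply: ler_sum.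
move: dist_m; set D := \sum_i `|a i - _|; set E := \sum_i _ => dist_m E_le.
have : D / n%:R <= 5 / 6 by rewrite ler_pdivrMr //; lra.
lra.
Qed.

Local Open Scope classical_set_scope.

Theorem proposition1p4 (R : realType) (p : R) (hp : 1 <= p) :
  (ereal_sup [set Gamma (2 ^ n)%N (pball p n) | n in [set n : nat | (2 <= n)%N]]
     <= ((5 / 6) `^ p^-1)%:E)%E.
Proof.
apply: ge_ereal_sup => _ [n /= n_ge2 <-].
apply: ereal_inf_lbound; exists ((5 / 6) `^ p^-1) => //=; split.
  by rewrite powR_gt0; lra.
have [k [k_half k_ok card_le]] := exists_lattice_radius n_ge2.
have [s [size_s in_s]] := sphere_enum n k.
(* Positions beyond the end of [s] give the default [[::]], which pads the family to [2 ^ n]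
   centres. *)
exists (fun i => lattice_center p n (nth [::] s i)) => x x_ball.
have [v [size_v norm_v x_v]] := pball_covered hp (ltnW n_ge2) k_half k_ok x_ball.
have s_v := in_s v size_v norm_v.
have lt_v : (index v s < 2 ^ n)%N.
  by apply: leq_trans card_le; rewrite -size_s index_mem.
by exists (Ordinal lt_v) => //=; rewrite nth_index.
Qed.
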